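(* Let $R$ be a principal ideal domain, let $n\geq 3$ and let $A\in\mathfrak{sl}_n(R)$. Then there exist matrices $X,Y\in\mathfrak{sl}_n(R)$ such that $[X,Y]=A$, where $X$ can be chosen such that $X_{\mathfrak p}$ is $\mathfrak{gl}_n(R/\mathfrak p)$-regular for every maximal ideal $\mathfrak p$ of $R$. Moreover, $X$ can be chosen such that $X_{\mathfrak p}$ is $\mathfrak{sl}_n(R/\mathfrak p)$-regular for every maximal ideal $\mathfrak p$ of $R$ such that $A_{\mathfrak p}$ is not scalar.
   Context: Fields are regarded as special cases of principal ideal domains. For a commutative ring $S$ with identity, $\mathfrak{gl}_n(S)$ is the Lie algebra of $n\times n$ matrices over $S$ with bracket $[X,Y]=XY-YX$, and $\mathfrak{sl}_n(S)$ is the sub Lie algebra of trace zero matrices. For an ideal $\mathfrak p$ of $R$ and $X\in\mathfrak{gl}_n(R)$, $X_{\mathfrak p}$ denotes the image of $X$ in $\mathfrak{gl}_n(R/\mathfrak p)$. A matrix is scalar if it is a scalar multiple of the identity matrix $1_n$. For a field $K$: $X\in\mathfrak{gl}_n(K)$ is $\mathfrak{gl}_n(K)$-regular if its centraliser $C_{\mathfrak{gl}_n(K)}(X)=\{Z\in \mathfrak{gl}_n(K): ZX=XZ\}$ equals the unital algebra $K[X]$ generated by $X$ (equivalently, the centraliser has dimension $n$); $X\in\mathfrak{sl}_n(K)$ is $\mathfrak{sl}_n(K)$-regular if $\dim_K C_{\mathfrak{sl}_n(K)}(X)=n-1$, where $C_{\mathfrak{sl}_n(K)}(X)=\{Z\in\mathfrak{sl}_n(K):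 ZX=XZ\}$. *)

(* Defs.v *)
From HB Require Import structures.
From mathcomp Require Import all_boot all_order all_algebra.
From mathcomp Require Import boolp.
Set Implicit Arguments.
Unset Strict Implicit.
Unset Printing Implicit Defensive.
Import GRing.Theory.
Local Open Scope ring_scope.

(* Ideals are boolean predicates, as in mathcomp's ring_quotient. Under the
   axioms of boolp every subset of R is of this form. *)
Definition is_pid (R : idomainType) : Prop :=
  forall I : {pred R},
    0 \in I -> (forall a, {in I &, forall u v, a * u + v \in I}) ->
    exists d, forall x, x \in I <-> exists r, x = r * d.

Section ResidueField.
Variable R : comNzRingType.

(* An [idealr R] is proper by definition. *)
Record maxideal := MaxIdeal {
  ideal_of_max :> idealr R;
  maxidealP : forall J : idealr R,
    {subset (ideal_of_max : pred R) <= (J : pred R)} ->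
    (J : pred R) =i (ideal_of_max : pred R)
}.

Variable p : maxideal.

Definition residue_field := {ideal_quot p}.

HB.instance Definition _ := GRing.ComNzRing.on residue_field.

Definition to_residue (x : R) : residue_field := (\pi_({ideal_quot p}) x)%qT.

Lemma to_residue_is_zmod_morphism : zmod_morphism to_residue.
Proof. exact: pi_is_zmod_morphism. Qed.

Lemma to_residue_is_monoid_morphism : monoid_morphism to_residue.
Proof. exact: pi_is_monoid_morphism. Qed.

HB.instance Definition _ :=
  GRing.isZmodMorphism.Build R residue_field to_residue
    to_residue_is_zmod_morphism.
HB.instance Definition _ :=
  GRing.isMonoidMorphism.Build R residue_field to_residue
    to_residue_is_monoid_morphism.

Lemma to_residue_surj (y : residue_field) : exists x, y = to_residue x.
Proof. by exists (repr y); rewrite /to_residue reprK. Qed.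

Lemma to_residue_eq0 x : (to_residue x == 0) = (x \in (p : pred R)).
Proof.
rewrite -(raddf0 to_residue) /to_residue.
by rewrite -[x in RHS]subr0 Quotient.idealrBE.
Qed.

Lemma residue_unit (x : residue_field) : x != 0 -> exists y, y * x == 1.
Proof.
have [r ->] := to_residue_surj x; rewrite to_residue_eq0 => rNp.
pose J : pred R := fun z => `[< exists a, z - a * r \in (p : pred R) >].
have JP z : reflect (exists a, z - a * r \in (p : pred R)) (z \in J).
  exact: asboolP.
have [/JP[a Ha]|J1] := boolP (1 \in J).
  exists (to_residue a); rewrite -rmorphM -(rmorph1 to_residue).
  by rewrite eq_sym -subr_eq0 -rmorphB to_residue_eq0.
have Jid : idealr_closed J.
  split=> //; first by apply/JP; exists 0; rewrite mul0r subr0 rpred0.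
  move=> a u v /JP[b Hb] /JP[c Hc]; apply/JP; exists (a * b + c).
  have -> : a * u + v - (a * b + c) * r = a * (u - b * r) + (v - c * r).
    by rewrite mulrDl opprD mulrBr -!mulrA addrACA.
  by rewrite rpredD // idealMr.
pose mJ := isIdealr.Build R J Jid.
pose J' : idealr R := HB.pack J mJ.
have := @maxidealP p J' _ r; case/negP: rNp; rewrite -(@maxidealP p J').
  by apply/JP; exists 1; rewrite mul1r subrr rpred0.
by move=> z zp; apply/JP; exists 0; rewrite mul0r subr0.
Qed.

(* As on every fieldType, the inverse of 0 is 0. *)
Definition residue_inv (x : residue_field) : residue_field :=
  if pselect (exists y, y * x == 1) is left h then xchoose h else 0.

Lemma residue_mulVf (x : residue_field) : x != 0 -> residue_inv x * x = 1.
Proof.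
move=> /residue_unit x0; rewrite /residue_inv.
by case: pselect => // h; apply/eqP/(xchooseP h).
Qed.

Lemma residue_inv0 : residue_inv 0 = 0.
Proof.
rewrite /residue_inv; case: pselect => // h.
by have [y] := h; rewrite mulr0 eq_sym oner_eq0.
Qed.

HB.instance Definition _ :=
  GRing.ComNzRing_isField.Build residue_field residue_mulVf residue_inv0.

Definition mod_max n (X : 'M[R]_n) : 'M[residue_field]_n :=
  map_mx to_residue X.

End ResidueField.

Definition lie_mx (R : comNzRingType) n (X Y : 'M[R]_n) : 'M[R]_n :=
  X *m Y - Y *m X.

Definition sl_mx (R : comNzRingType) n : {pred 'M[R]_n} :=
  [pred X | \tr X == 0].
Arguments sl_mx R n : clear implicits.

Section Regular.
Variables (K : fieldType) (n : nat).
Implicit Types X Z : 'M[K]_n.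

Definition cent_gl X : {vspace 'M[K]_n} :=
  lker (linfun (mulmxr X \- mulmx X)).

Lemma mem_cent_gl X Z : (Z \in cent_gl X) = (Z *m X == X *m Z).
Proof. by rewrite memv_ker lfunE /= subr_eq0. Qed.

Definition slv : {vspace 'M[K]_n} :=
  lker (linfun (@mxtrace K n : 'M[K]_n -> K^o)).

Lemma mem_slv Z : (Z \in slv) = (Z \in sl_mx K n).
Proof. by rewrite memv_ker lfunE. Qed.

Definition cent_sl X : {vspace 'M[K]_n} := (slv :&: cent_gl X)%VS.

(* [horner_mx] is only available for sizes of the form n.+1. *)
Definition poly_mx X (f : {poly K}) : 'M[K]_n :=
  \sum_(i < size f) f`_i *: X ^+ i.

Definition gl_regular X : Prop :=
  forall Z, Z \in cent_gl X <-> exists f : {poly K}, Z = poly_mx X f.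

Definition sl_regular X : Prop := \dim (cent_sl X) = n.-1.

End Regular.

Lemma poly_mxE (K : fieldType) n (X : 'M[K]_n.+1) f :
  poly_mx X f = horner_mx X f.
Proof.
rewrite -[f in RHS]coefK poly_def rmorph_sum; apply: eq_bigr => i _ /=.
by rewrite horner_mxZ rmorphXn /= horner_mx_X.
Qed.

(* Main.v *)
Require Import Defs.
From mathcomp Require Import all_boot all_order all_algebra.
From mathcomp Require Import perm boolp ring zify.
Import GRing.Theory.
Local Open Scope ring_scope.
Set Implicit Arguments.
Unset Strict Implicit.
Unset Printing Implicit Defensive.

(* Let n = m + 1.  By a minimality argument with respect to divisibility, [A] is
   conjugate to g (a + d B) with a, d coprime and (0, ..., 0, 1) as first row
   of B.  Let S be the m x m companion matrix of x^m - d, acting as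
   f_0 -> f_1 -> ... -> f_(m-1) -> d f_0.  A further conjugation by a
   unipotent matrix achieves tr (S^r B') = 0 for 0 < r < m, where B' is the
   lower right block of B.  Then X = [[0, 0], [a f_0, S]] works:
   - modulo p it has a cyclic vector because a, d are not both 0;
   - tr 1 = n and tr X^m = m d are not both 0 modulo p when d is not, and d is
     nonzero modulo p whenever A is not scalar modulo p;
   - n a + d tr B = 0 makes the trace obstructions to solving [X, Y] = a + d B
     vanish, and Y is found column by column.  The diagonal of its lower right
     block is divisible by d, which leaves room to make tr Y vanish. *)

(** * Divisibility in a principal ideal domain *)

Section PrincipalIdeals.
Variable R : idomainType.
Hypothesis R_pid : is_pid R.

Definition divides (x y : R) := exists q : R, y = q * x.

Lemma bezout (x y : R) : exists g x' y' l k : R,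
  [/\ x = g * x', y = g * y' & l * x' + k * y' = 1].
Proof.
pose I : {pred R} := [pred z | `[< exists l k, z = l * x + k * y >]].
have I0 : 0 \in I by apply/asboolP; exists 0, 0; ring.
have Iid a : {in I &, forall u v, a * u + v \in I}.
  move=> u v /asboolP[l [k ->]] /asboolP[l' [k' ->]]; apply/asboolP.
  by exists (a * l + l'), (a * k + k'); ring.
have [g Ig] := R_pid I0 Iid.
have /asboolP[l [k gE]] : g \in I by apply/Ig; exists 1; rewrite mul1r.
have [x' xE] : divides g x by apply/Ig/asboolP; exists 1, 0; ring.
have [y' yE] : divides g y by apply/Ig/asboolP; exists 0, 1; ring.
(* For [x = y = 0] nothing can be cancelled, so coprime cofactors 1 and 0 are supplied by hand. *)
have [g0|g_neq0] := eqVneq g 0.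
  by exists 0, 1, 0, 1, 0; split; [rewrite xE g0|rewrite yE g0|]; ring.
exists g, x', y', l, k; split; [by rewrite mulrC | by rewrite mulrC |].
apply: (mulIf g_neq0); rewrite mul1r [RHS]gE xE yE; ring.
Qed.

(** Ascending chain condition: without a minimal element, choice gives a sequence of ever more
    proper divisors [c i]. The union of the ideals they generate is principal, and its generator
    already lies in one of them, so the chain stops. *)
Lemma divides_minimal (P : R -> Prop) x0 : P x0 ->
  exists2 x, P x & forall y, P y -> divides y x -> divides x y.
Proof.
move=> Px0; apply: contrapT => noMin.
have /choice[next nextP] (x : R) : exists y,
    P x -> [/\ P y, divides y x & ~ divides x y].
  have [Px|nPx] := pselect (P x); last by exists 0.
  apply: contrapT => none; apply: noMin; exists x => // y Py yx.
  by apply: contrapT => nxy; apply: none; exists y.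
pose c i := iter i next x0.
have cP i : P (c i) by elim: i => //= i /nextP[].
pose I : {pred R} := [pred z | `[< exists i, divides (c i) z >]].
have cmono i j : divides (c (i + j)%N) (c i).
  elim: j => [|j [q cE]]; first by rewrite addn0; exists 1; rewrite mul1r.
  have [_ [q' cE'] _] := nextP _ (cP (i + j)%N).
  by exists (q * q'); rewrite addnS /= cE -/(c _) [in LHS]cE' mulrA.
have I0 : 0 \in I by apply/asboolP; exists 0%N, 0; rewrite mul0r.
have Iid a : {in I &, forall u v, a * u + v \in I}.
  move=> u v /asboolP[i [q ->]] /asboolP[j [q' ->]]; apply/asboolP.
  have [[s sE] [t tE]] := (cmono i j, cmono j i).
  exists (i + j)%N, (a * q * s + q' * t); rewrite [in LHS]sE [in LHS]tE.
  rewrite [(j + i)%N]addnC; ring.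
have [g Ig] := R_pid I0 Iid.
have /asboolP[i [q gE]] : g \in I by apply/Ig; exists 1; rewrite mul1r.
have [r rE] : divides g (c i.+1).
  by apply/Ig/asboolP; exists i.+1, 1; rewrite mul1r.
have [_ _] := nextP _ (cP i); apply; exists (r * q).
by rewrite -mulrA -gE.
Qed.

End PrincipalIdeals.

(** * Completing unimodular rows to invertible matrices *)

Section Completion.
Variable R : idomainType.
Hypothesis R_pid : is_pid R.

(** Induction clears the tail of the row up to its leading entry; one Bezout step then merges the
    first two entries. *)
Lemma row_reduction n (r : 'rV[R]_n.+1) :
  exists2 Q, Q \in unitmx & exists c, r *m Q = c *: delta_mx 0 0.
Proof.
elim: n r => [|n IHn] r.
  exists 1%:M; rewrite ?unitmx1 //; exists (r 0 0); rewrite mulmx1.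
  by apply/rowP => i; rewrite !mxE !ord1 /= mulr1.
have [Q' Q'u [c' r'E]] := IHn (rsubmx (r : 'rV_(1 + n.+1))).
pose Q1 : 'M[R]_(1 + n.+1) := block_mx 1%:M 0 0 Q'.
have Q1u : Q1 \in unitmx by rewrite unitmxE det_lblock det1 mul1r -unitmxE.
have [g [x [y [l [k [xE yE lk]]]]]] := bezout R_pid (r 0 0) c'.
(* The determinant is [l * x + k * y = 1], and multiplication by this matrix sends [(g x, g y)] to
   [(g, 0)]. *)
pose E l k x y : 'M[R]_2 := \matrix_(i, j)
  if i == 0 then (if j == 0 then l else - y) else (if j == 0 then k else x).
have [Eu _] : E l k x y \in unitmx /\ E x (- k) l (- y) \in unitmx.
  apply: mulmx1_unit; apply/matrixP => i j; rewrite !mxE !big_ord_recl big_ord0.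
  rewrite !mxE /= -lk.
  by case: i => [[|[|]]] //= ?; case: j => [[|[|]]] //= ?;
    rewrite ?eqxx /=; ring.
pose Q2 : 'M[R]_(2 + n) := block_mx (E l k x y) 0 0 1%:M.
have Q2u : Q2 \in unitmx by rewrite unitmxE det_lblock det1 mulr1 -unitmxE.
exists (Q1 *m Q2); first by rewrite unitmx_mul Q1u.
exists g; rewrite mulmxA.
have -> : r *m Q1 = row_mx (\row_(j < 2) if j == 0 then r 0 0 else c') 0.
  have -> : r *m Q1 = row_mx (lsubmx (r : 'rV_(1 + n.+1))) (c' *: delta_mx 0 0).
    rewrite -r'E -[X in X *m Q1](@hsubmxK _ 1 1 n.+1 r).
    rewrite (mul_row_block (lsubmx (r : 'rV_(1 + n.+1)))).
    by rewrite !mulmx0 mulmx1 addr0 add0r.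
  apply/rowP => j; rewrite [RHS]mxE mxE.
  case: splitP => i jE; case: splitP => i' ji.
  - rewrite !mxE; case: eqP => [i0|[]].
      by congr (r _ _); apply/val_inj; rewrite /= ord1.
    by apply/val_inj; rewrite /= -ji jE ord1.
  - by move: ji; rewrite jE ord1 /=.
  - rewrite !mxE eqxx /=; have [i0|ne] := eqVneq i' 0.
      by move: ji; rewrite i0 jE.
    rewrite (_ : i = 0) ?eqxx ?mulr1 //; apply/val_inj.
    have : (i' : nat) != 0%N by apply: contra_neq ne => ?; apply/val_inj.
    by have := etrans (esym jE) ji; move: (ltn_ord i') => /=; lia.
  - rewrite !mxE eqxx /=; have [i0|] := eqVneq i 0; last by rewrite mulr0.
    by have := etrans (esym jE) ji; rewrite i0 /=; lia.
rewrite [LHS](mul_row_block (\row_(j < 2) if j == 0 then r 0 0 else c')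
  (0 : 'rV_n) (E l k x y) 0 0 1%:M).
rewrite !mul0mx !mulmx0 !addr0; apply/rowP => j; rewrite [LHS]mxE [RHS]mxE.
case: splitP => i jE; rewrite !mxE eqxx /=; last first.
  by have [j0|] := eqVneq j 0; [move: jE; rewrite j0|rewrite mulr0].
rewrite !big_ord_recl big_ord0 !mxE /= xE yE.
have -> : (j == 0) = (i == 0) by rewrite -!val_eqE /= jE.
by case: eqP => i0 /=; [rewrite -lk|]; ring.
Qed.

(** The gcd [c] left by row reduction divides [r *m x], hence is a unit, and [c *: invmx Q] has [r]
    as row 0. *)
Lemma unimodular_row_completion n (r : 'rV[R]_n.+1) (x : 'cV_n.+1) i :
  (r *m x) 0 0 = 1 -> exists2 P, P \in unitmx & row i P = r.
Proof.
have [Q Qu [c rE]] := row_reduction r => rx1.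
have cu : c \is a GRing.unit.
  apply/unitrP; exists ((invmx Q *m x) 0 0).
  have E : c * (invmx Q *m x) 0 0 = 1.
    by rewrite -rx1 -[r in RHS](mulmxK Qu) rE -mulmxA -scalemxAl -rowE !mxE.
  by rewrite mulrC E.
exists (tperm_mx i 0 *m (c *: invmx Q)).
  by rewrite unitmx_mul unitmxZ // unitmx_inv Qu unitmx_perm.
rewrite -xrowE -[r in RHS](mulmxK Qu) rE -scalemxAl -rowE.
by apply/rowP => j; rewrite !mxE tpermL.
Qed.

(* In coordinates where [v] is the first basis covector, [eta] is completed
   inside the complementary block. *)
Lemma unimodular_pair_completion n (v eta : 'rV[R]_n.+2) (x w : 'cV_n.+2) :
    (v *m x) 0 0 = 1 -> (v *m w) 0 0 = 0 -> (eta *m w) 0 0 = 1 ->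
  exists P, [/\ P \in unitmx, row 0 P = v & row ord_max P = eta].
Proof.
move=> vx vw ew.
have [P1 P1u vE] := unimodular_row_completion 0 vx.
pose eta1 : 'rV_(1 + n.+1) := eta *m invmx P1.
pose w1 : 'cV_(1 + n.+1) := P1 *m w.
have ew1 : eta *m w = eta1 *m w1 by rewrite mulmxA mulmxKV.
have w10 : usubmx w1 = 0.
  apply/matrixP => i j; rewrite !ord1 [RHS]mxE -[RHS]vw -vE !mxE.
  by apply: eq_bigr => k _; rewrite mxE; congr (P1 _ _ * _); apply/val_inj.
have [P2 P2u P2E] : exists2 P2, P2 \in unitmx & row ord_max P2 = rsubmx eta1.
  apply: (@unimodular_row_completion _ _ (dsubmx w1)).
  rewrite -ew ew1 -[eta1 in RHS]hsubmxK -[w1 in RHS]vsubmxK w10.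
  by rewrite mul_row_col mulmx0 add0r.
pose P3 : 'M_(1 + n.+1) :=
  block_mx 1%:M 0 (delta_mx ord_max 0 *m lsubmx eta1) P2.
have P3u : P3 \in unitmx by rewrite unitmxE det_lblock det1 mul1r -unitmxE.
exists (P3 *m P1); split; first by rewrite unitmx_mul P3u.
- rewrite row_mul -[RHS]vE [RHS]rowE; congr (_ *m _).
  have <- : row (lshift n.+1 0) P3 = delta_mx 0 0.
    rewrite /P3 block_mxEv rowKu; apply/rowP => j; rewrite !mxE eqxx /=.
    by case: splitP => k jE; rewrite !mxE -[j == 0]val_eqE /= jE ?ord1.
  by congr (row _ _); apply/val_inj.
- rewrite row_mul -[RHS](mulmxKV P1u) -/eta1; congr (_ *m _).
  have <- : row (rshift 1 ord_max) P3 = eta1.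
    rewrite /P3 block_mxEv rowKd row_row_mx P2E row_mul.
    by rewrite [row _ (delta_mx _ _)]rowE mul_delta_mx
      [delta_mx 0 0]mx11_scalar mxE mul1mx hsubmxK.
  by congr (row _ _); apply/val_inj.
Qed.
End Completion.

(** * Matrices that are scalar modulo a minimal off-scalar value *)

Section Minimal.
Variable R : idomainType.
Hypothesis R_pid : is_pid R.
Variable n : nat.
Implicit Types (u v eta : 'rV[R]_n) (x y z w : 'cV[R]_n) (A : 'M[R]_n).

Definition dot v z : R := (v *m z) 0 0.

Lemma dotDl u v z : dot (u + v) z = dot u z + dot v z.
Proof. by rewrite /dot mulmxDl mxE. Qed.
Lemma dotNl v z : dot (- v) z = - dot v z.
Proof. by rewrite /dot mulNmx mxE. Qed.
Lemma dotZl a v z : dot (a *: v) z = a * dot v z.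
Proof. by rewrite /dot -scalemxAl mxE. Qed.
Lemma dotDr v y z : dot v (y + z) = dot v y + dot v z.
Proof. by rewrite /dot mulmxDr mxE. Qed.
Lemma dotNr v z : dot v (- z) = - dot v z.
Proof. by rewrite /dot mulmxN mxE. Qed.
Lemma dotZr a v z : dot v (a *: z) = a * dot v z.
Proof. by rewrite /dot -scalemxAr mxE. Qed.
Definition dotE := (dotDl, dotNl, dotZl, dotDr, dotNr, dotZr).

(** The witness [x] makes [v] unimodular. The values [c] measure how far unimodular covectors are
    from being eigenvectors of [A]. *)
Definition off_scalar A c :=
  exists v x z, [/\ dot v x = 1, dot v z = 0 & c = dot (v *m A) z].

Definition minimal_off_scalar A c :=
  off_scalar A c /\ forall c', off_scalar A c' -> divides c' c -> divides c c'.

Variables (A : 'M[R]_n) (del lam : R).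
Hypothesis del_min : minimal_off_scalar A del.

(** The gcd of the values at [z] and [z'] is itself attained, at a combination of [z] and [z'], and
    it divides [del]; by minimality [del] divides it. *)
Lemma minimal_off_scalar_divides v x z z' :
    dot v x = 1 -> dot v z = 0 -> dot v z' = 0 ->
  divides (dot (v *m A) z) del -> divides del (dot (v *m A) z').
Proof.
move=> vx vz vz' [q delE].
have [g [c [c' [l [k [cE c'E lk]]]]]] :=
  bezout R_pid (dot (v *m A) z) (dot (v *m A) z').
have [r gE] : divides del g.
  case: del_min => _; apply; last by exists (q * c); rewrite delE cE; ring.
  exists v, x, (l *: z + k *: z'); split=> //; rewrite !dotE ?vz ?vz' ?cE ?c'E.
    by ring.
  by rewrite -[LHS]mulr1 -lk; ring.
by exists (r * c'); rewrite c'E gE; ring.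
Qed.

(* Here [v, u, eta] and [x, y, w] are dual families.  Minimality of [del] is
   applied to the unimodular covectors [v + u] and [d' v + u], for suitable d'. *)
Lemma scalar_mod_normalized v eta x w u y :
    v *m A = lam *: v + del *: eta ->
    dot v x = 1 -> dot v w = 0 -> dot eta w = 1 -> dot eta x = 0 ->
    dot u y = 1 -> dot v y = 0 -> dot u x = 0 -> dot u w = 0 ->
    dot eta y = 0 -> dot (u *m A) w = 0 ->
  forall z, divides del (dot (u *m A) z - lam * dot u z).
Proof.
move=> vA vx vw ew ex uy vy ux uw ey uAw.
set al := dot (u *m A) x; set be := dot (u *m A) y.
(* At [w], which [v + u] kills, [(v + u) *m A] takes the value [del] itself. *)
have step z : dot (v + u) z = 0 -> divides del (dot ((v + u) *m A) z).
  move=> z0; apply: (@minimal_off_scalar_divides _ x w) => //.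
  - by rewrite dotE vx ux addr0.
  - by rewrite dotE vw uw addr0.
  - by exists 1; rewrite mulmxDl vA !dotE vw ew uAw; ring.
have [k kE] : divides del (lam + al - be).
  have [|q qE] := step (x - y); first by rewrite !dotE vx uy vy ux; ring.
  exists q; rewrite -qE mulmxDl vA !dotE vx vy ex ey -/al -/be; ring.
have del_al : divides del al.
  have [g [d' [a' [l [m [dE aE lm]]]]]] := bezout R_pid del al.
  (* The covector [d' v + u] takes the values [g d'^2] and
     [g (a' (1 - d') + d'^2 k)] on [w] and [x - d' y]; [th] yields a Bezout
     relation between the cofactors of [g]. *)
  pose th := l + 1 - l * d' - m * d' * k.
  have [||r gE] := (del_min.2 g); last by exists (r * a'); rewrite aE gE; ring.
    exists (d' *: v + u), y,
      (th ^+ 2 *: w + (m * (1 + d' * th)) *: (x - d' *: y)).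
    split; rewrite ?(mulmxDl, =^~ scalemxAl) ?vA !dotE
      ?vx ?vy ?vw ?ux ?uy ?uw ?ex ?ey ?ew ?uAw -/al -/be; try ring.
    have key : m * (a' * (1 - d') + d' ^+ 2 * k) = 1 - d' * th.
      have ma : m * a' = 1 - l * d' by rewrite -lm; ring.
      by rewrite mulrDr mulrA ma /th; ring.
    have -> : be = lam + al - k * del by rewrite -kE; ring.
    rewrite aE dE; clearbody th; move: key.
    transitivity (g * (d' ^+ 2 * th ^+ 2 + (1 + d' * th) * (1 - d' * th))).
      by ring.
    by rewrite -key; ring.
  by exists d'; rewrite dE mulrC.
have [kbe beE] : divides del (lam - be).
  case: del_al => q qE; exists (k - q); rewrite mulrBl -kE -qE; ring.
case: del_al => q alE z.
(* Removing the components along [x] and [y] leaves a vector killed by both [v] and [u], to which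
   [step] applies; the components are governed by [al] and [be]. *)
have [r rE] : divides del (dot (u *m A) (z - dot v z *: x - dot u z *: y)).
  have [|r rE] := step (z - dot v z *: x - dot u z *: y).
    by rewrite !dotE vx vy ux uy; ring.
  exists (r - dot eta z); rewrite mulrBl -rE mulmxDl vA !dotE vx vy ex ey; ring.
exists (r + dot v z * q - dot u z * kbe).
rewrite !mulrDl mulNr -!mulrA -rE -alE -beE !dotE -/al -/be; ring.
Qed.

(** Reduction to the normalized case. Adding multiples of [v] to [u] is harmless because [v *m A] is
    [lam *: v] modulo [del]. *)
Lemma scalar_mod_complement v eta x w u y :
    v *m A = lam *: v + del *: eta ->
    dot v x = 1 -> dot v w = 0 -> dot eta w = 1 -> dot eta x = 0 ->
    dot u y = 1 -> dot v y = 0 -> dot eta y = 0 ->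
  forall z, divides del (dot (u *m A) z - lam * dot u z).
Proof.
move=> vA vx vw ew ex uy vy ey z.
have [u0 [c [uE u0y u0x]]] :
    exists u0 c, [/\ u = u0 + c *: v, dot u0 y = 1 & dot u0 x = 0].
  exists (u - dot u x *: v), (dot u x).
  by rewrite subrK !dotE uy vy vx; split=> //; ring.
have [w0 [u0w vw0 ew0]] :
    exists w0, [/\ dot u0 w0 = 0, dot v w0 = 0 & dot eta w0 = 1].
  by exists (w - dot u0 w *: y); rewrite !dotE u0y vw vy ew ey; split; ring.
have [kap omE] : divides del (dot (u0 *m A) w0).
  (* The covector [s *: v + t *: u0] is unimodular and attains the gcd [g] at [w0], so [del] divides
     [g]. *)
  have [g [d' [o' [s [t [dE oE st]]]]]] := bezout R_pid del (dot (u0 *m A) w0).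
  have [||r gE] := (del_min.2 g); last by exists (r * o'); rewrite oE gE; ring.
    exists (s *: v + t *: u0), (d' *: x + o' *: y), w0; split.
    - rewrite ![dot (_ + _) _]dotDl !dotZl !dotDr !dotZr vx vy u0x u0y.
      by rewrite -[RHS]st; ring.
    - by rewrite dotDl !dotZl vw0 u0w; ring.
    - rewrite mulmxDl -!scalemxAl vA !(dotDl, dotZl) vw0 ew0 oE [in RHS]dE.
      by rewrite -[g in LHS]mulr1 -[1 in LHS]st; ring.
  by exists d'; rewrite dE mulrC.
(* The shift by [kap *: v] makes [u1 *m A] vanish at [w0]; [x1] restores the duality
   [dot u1 x1 = 0]. *)
pose u1 := u0 - kap *: v; pose x1 := x + kap *: y.
have [r rE] : divides del (dot (u1 *m A) z - lam * dot u1 z).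
  by apply: (@scalar_mod_normalized v eta x1 w0 u1 y vA);
    rewrite ?mulmxDl ?mulNmx -?scalemxAl ?vA
      ?(dotDl, dotNl, dotZl, dotDr, dotNr, dotZr)
      ?vx ?vy ?u0x ?u0y ?vw0 ?ew0 ?ex ?ey ?u0w ?omE; ring.
exists (r + (kap + c) * dot eta z).
rewrite mulrDl -rE /u1 uE !mulmxDl !mulNmx -!scalemxAl vA.
rewrite !(dotDl, dotNl, dotZl); ring.
Qed.
End Minimal.

(** * Normal form of a trace zero matrix under conjugation *)

Section NormalForm.
Variable R : idomainType.
Hypothesis R_pid : is_pid R.

Lemma divides_row n (r : 'rV[R]_n) d :
  (forall z, divides d (dot r z)) -> exists s, r = d *: s.
Proof.
move=> rP; have /choice[f fP] (j : 'I_n) : exists c, r 0 j = c * d.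
  by have [c cE] := rP (delta_mx j 0); exists c; rewrite -cE /dot -colE mxE.
by exists (\row_j f j); apply/rowP => j; rewrite !mxE fP mulrC.
Qed.

Lemma divides_mx n (M : 'M[R]_n) d :
  (forall v z, divides d (dot (v *m M) z)) -> exists B, M = d *: B.
Proof.
move=> MP; have /choice[f fP] (i : 'I_n) : exists s, row i M = d *: s.
  by apply: divides_row => z; rewrite rowE.
by exists (\matrix_i f i); apply/row_matrixP => i; rewrite linearZ /= rowK.
Qed.

Lemma off_scalar_eq0 n (A : 'M[R]_n.+1) :
  (forall c, off_scalar A c -> c = 0) -> A = (A 0 0)%:M.
Proof.
pose e i : 'rV[R]_n.+1 := delta_mx 0 i; pose f i : 'cV[R]_n.+1 := delta_mx i 0.
have ef i j : dot (e i) (f j) = (i == j)%:R.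
  by rewrite /dot /e /f -rowE !mxE eqxx andbT.
have eAf i j : dot (e i *m A) (f j) = A i j.
  by rewrite /dot /e /f -rowE -colE !mxE.
move=> A0.
have off i j : i != j -> A i j = 0.
  move=> ij; apply: A0; exists (e i), (f i), (f j).
  by rewrite !ef eqxx (negbTE ij) eAf.
have diag i : A i i = A 0 0.
  have [->//|i0] := eqVneq i 0.
  apply/eqP; rewrite -subr_eq0; apply/eqP/A0.
  (* Once the off-diagonal entries vanish, the value attained here is [A i i - A 0 0]. *)
  exists (e i + e 0), (f i), (f i - f 0).
  have i0' : 0 != i by rewrite eq_sym.
  rewrite mulmxDl !dotE !ef !eAf !eqxx (negbTE i0) (negbTE i0').
  rewrite (off _ _ i0) (off _ _ i0').
  by split=> /=; ring.
apply/matrixP => i j; rewrite !mxE; have [->|ij] := eqVneq i j.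
  by rewrite diag mulr1n.
by rewrite off // mulr0n.
Qed.

(** For a minimal off-scalar value [del], attained by [v], one has [v *m A = lam *: v + del *: eta],
    and [A] is [lam] modulo [del]. A basis of covectors from [v] to [eta] gives the first row of
    [B], and [g] is the gcd of [lam] and [del]. *)
Lemma trace0_normal_form n (A : 'M[R]_n.+3) : \tr A = 0 ->
  exists P g a d l k B,
    [/\ P \in unitmx, P *m A *m invmx P = g *: (a%:M + d *: B),
        l * a + k * d = 1, a *+ n.+3 + d * \tr B = 0
      & row 0 B = delta_mx 0 ord_max].
Proof.
move=> trA.
have [|del del_off del_min] := @divides_minimal _ R_pid (off_scalar A)
  (dot (delta_mx 0 0 *m A) (delta_mx ord_max 0)).
  exists (delta_mx 0 0), (delta_mx 0 0), (delta_mx ord_max 0).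
  by rewrite /dot !mul_delta_mx_cond !mxE.
have [del0|del_neq0] := eqVneq del 0.
  have {}AE : A = (A 0 0)%:M.
    apply: off_scalar_eq0 => c c_off.
    have [|q ->] := del_min c c_off; first by exists 0; rewrite del0 mul0r.
    by rewrite del0 mulr0.
  pose B : 'M[R]_n.+3 := delta_mx 0 ord_max.
  have trB : \tr B = 0.
    by rewrite /mxtrace big1 // => i _; rewrite mxE; case: eqP => // ->.
  have rowB : row 0 B = delta_mx 0 ord_max by rewrite rowE mul_delta_mx.
  (* If [A] is a nonzero scalar, trace zero forces [n.+3] to vanish in [R], so [a = 1], [d = 0] is
     allowed; if [A = 0], then [g = 0] absorbs everything. *)
  have [A00|A00] := eqVneq (A 0 0) 0.
    exists 1%:M, 0, 0, 1, 0, 1, B; rewrite unitmx1 trB; split=> //; try ring.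
      by rewrite AE A00 scale0r raddf0 mulmx0 mul0mx.

  exists 1%:M, (A 0 0), 1, 0, 1, 0, B; rewrite unitmx1 trB; split=> //; try ring.
    by rewrite mul1mx invmx1 mulmx1 scale0r addr0 scale_scalar_mx mulr1.
  apply: (mulfI A00); rewrite !mulr0 addr0 mulr_natr -mxtrace_scalar.
  by rewrite -AE.
have [v [x [w [vx vw delE]]]] := del_off.
pose lam := dot (v *m A) x.
have [eta vA'] : exists eta, v *m A - lam *: v = del *: eta.
  apply: divides_row => z.
  have [||q qE] := @minimal_off_scalar_divides _ R_pid _ _ _
    (conj del_off del_min) v x w (z - dot v z *: x) vx vw.
  - by rewrite !dotE vx; ring.
  - by exists 1; rewrite mul1r -delE.
  by exists q; rewrite -qE !dotE -/lam; ring.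
have vA : v *m A = lam *: v + del *: eta by rewrite -vA' addrC subrK.
have ew : dot eta w = 1.
  apply: (mulfI del_neq0); rewrite [RHS]mulr1 [RHS]delE vA !dotE vw; ring.
have ex : dot eta x = 0.
  apply: (mulfI del_neq0); rewrite mulr0 -dotZl -vA' !dotE vx -/lam; ring.
have [P [P_unit Pv Peta]] := unimodular_pair_completion R_pid vx vw ew.
have PP i j : dot (row i P) (col j (invmx P)) = (i == j)%:R.
  rewrite /dot rowE colE mulmxA -(mulmxA _ P) mulmxV // mulmx1.
  by rewrite mul_delta_mx_cond; case: eqP => _; rewrite ?mulr1n ?mulr0n !mxE.
(* Size at least 3 makes index 1 differ from 0 and [ord_max], so [y] is killed by [v] and [eta]. *)
pose u := row 1 P; pose y := col 1 (invmx P).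
have uy : dot u y = 1 by rewrite PP eqxx.
have [vy ey] : dot v y = 0 /\ dot eta y = 0 by rewrite -Pv -Peta !PP.
have modl := scalar_mod_complement R_pid (conj del_off del_min) vA vx vw ew ex.
have [B0 AE] : exists B0, A - lam%:M = del *: B0.
  (* [modl] requires value 1 at [y]; both [e'] and [u] have it, and [e] is a combination of them. *)
  apply: divides_mx => e z; pose e' := e + (1 - dot e y) *: u.
  have e'y : dot e' y = 1 by rewrite !dotE uy; ring.
  have [q qE] := modl e' y e'y vy ey z.
  have [r rE] := modl u y uy vy ey z.
  exists (q - (1 - dot e y) * r).
  rewrite mulmxBr mul_mx_scalar !dotE mulrBl -qE -mulrA -rE.
  by rewrite mulmxDl -scalemxAl !dotE; ring.
have [g [a [d [l [k [lamE dE lk]]]]]] := bezout R_pid lam del.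
have PAP : P *m A *m invmx P = g *: (a%:M + d *: (P *m B0 *m invmx P)).
  rewrite scalerDr scalerA -dE scale_scalar_mx -lamE.
  rewrite scalemxAl scalemxAr -AE mulmxBr mulmxBl mul_mx_scalar.
  by rewrite -scalemxAl mulmxV // scalemx1 addrC subrK.
exists P, g, a, d, l, k, (P *m B0 *m invmx P); split=> //.
  have g_neq0 : g != 0 by apply: contra_neq del_neq0 => g0; rewrite dE g0 mul0r.
  apply: (mulfI g_neq0).
  rewrite mulr0 -trA -[in RHS](mulKmx P_unit A) [in RHS]mxtrace_mulC PAP.
  by rewrite mxtraceZ mxtraceD mxtraceZ mxtrace_scalar.
have -> : row 0 (P *m B0 *m invmx P) = eta *m invmx P.
  rewrite !row_mul Pv; congr (_ *m _).
  have /rowP vB0 : del *: (v *m B0) = del *: eta.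
    by rewrite -vA' scalemxAr -AE mulmxBr mul_mx_scalar.
  apply/rowP => j; apply: (mulfI del_neq0); have := vB0 j.
  by rewrite mxE [RHS]mxE.
by rewrite -Peta -row_mul mulmxV // row1.
Qed.
End NormalForm.

(** * Cyclic vectors and regularity over a field *)

Section CyclicVectors.
Variables (K : fieldType) (n : nat).
Implicit Types (X Z : 'M[K]_n.+1) (c u : 'cV[K]_n.+1).

Definition cyclic_span X c u := exists f : {poly K}, u = horner_mx X f *m c.

Definition cyclic_vector X c := forall u, cyclic_span X c u.

Lemma cyclic_span_id X c : cyclic_span X c c.
Proof. by exists 1; rewrite rmorph1 mul1mx. Qed.

Lemma cyclic_spanD X c u v :
  cyclic_span X c u -> cyclic_span X c v -> cyclic_span X c (u + v).
Proof. by move=> [f ->] [g ->]; exists (f + g); rewrite rmorphD mulmxDl. Qed.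

Lemma cyclic_spanZ X c b u : cyclic_span X c u -> cyclic_span X c (b *: u).
Proof. by move=> [f ->]; exists (b *: f); rewrite horner_mxZ scalemxAl. Qed.

Lemma cyclic_spanM X c u : cyclic_span X c u -> cyclic_span X c (X *m u).
Proof.
by move=> [f ->]; exists ('X * f); rewrite rmorphM /= horner_mx_X mulmxA.
Qed.

Lemma cyclic_vector_basis X c :
  (forall i, cyclic_span X c (delta_mx i 0)) -> cyclic_vector X c.
Proof.
move=> cX u; rewrite [u]matrix_sum_delta.
apply: (big_ind (cyclic_span X c)) => [||i _].
- by exists 0; rewrite rmorph0 mul0mx.
- by move=> *; apply: cyclic_spanD.
by rewrite big_ord1; apply: cyclic_spanZ.
Qed.

Lemma cent_gl_horner X f : horner_mx X f \in cent_gl X.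
Proof.
by rewrite mem_cent_gl; apply/eqP/comm_horner_mx.
Qed.

(** A matrix commuting with [X] commutes with every polynomial in [X], so its value at [c]
    determines it. *)
Lemma cyclic_cent_inj X c Z Z' : cyclic_vector X c ->
  Z \in cent_gl X -> Z' \in cent_gl X -> Z *m c = Z' *m c -> Z = Z'.
Proof.
move=> cX; rewrite !mem_cent_gl => /eqP ZX /eqP Z'X Zc.
have comm W f : W *m X = X *m W -> W *m horner_mx X f = horner_mx X f *m W.
  by move=> WX; apply: comm_mx_horner.
have ZE j : col j Z = col j Z'.
  rewrite !colE; have [f ->] := cX (delta_mx j 0).
  by rewrite !mulmxA !comm // -!mulmxA Zc.
by apply/matrixP => i j; have /colP/(_ i) := ZE j; rewrite !mxE.
Qed.

Lemma cyclic_gl_regular X c : cyclic_vector X c -> gl_regular X.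
Proof.
move=> cX Z; split=> [ZX|[f ->]]; last by rewrite poly_mxE cent_gl_horner.
have [f Zc] := cX (Z *m c); exists f; rewrite poly_mxE.
by apply: (cyclic_cent_inj cX) => //; apply: cent_gl_horner.
Qed.

(** Evaluation at [c] is an isomorphism from the centraliser onto the column space. *)
Lemma cyclic_dim_cent_gl X c : cyclic_vector X c -> \dim (cent_gl X) = n.+1.
Proof.
move=> cX; pose ev := linfun (mulmxr c : 'M[K]_n.+1 -> 'cV[K]_n.+1).
have ker0 : (cent_gl X :&: lker ev = 0)%VS.
  apply/eqP; rewrite -subv0; apply/subvP => Z /memv_capP[ZX].
  rewrite memv_ker lfunE /= => /eqP Zc; rewrite memv0; apply/eqP.
  by apply: (cyclic_cent_inj cX ZX (mem0v _)); rewrite Zc mul0mx.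
rewrite -(limg_dim_eq ker0).
have -> : (ev @: cent_gl X)%VS = fullv.
  apply/eqP; rewrite eqEsubv subvf; apply/subvP => u _.
  have [f uE] := cX u; have -> : u = ev (horner_mx X f) by rewrite lfunE.
  by apply/memv_img/cent_gl_horner.
by rewrite dimvf /dim /= muln1.
Qed.

(** A trace form that is nonzero somewhere on the centraliser is onto, so its kernel there has
    codimension 1. *)
Lemma cyclic_sl_regular X c Z : cyclic_vector X c ->
  Z \in cent_gl X -> \tr Z != 0 -> sl_regular X.
Proof.
move=> cX ZX trZ; rewrite /sl_regular /cent_sl capvC /slv.
set tr := linfun _; have := limg_ker_dim tr (cent_gl X).
have trE W : tr W = \tr W by apply: lfunE.
rewrite (cyclic_dim_cent_gl cX).
have -> : (tr @: cent_gl X)%VS = fullv.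
  apply/eqP; rewrite eqEsubv subvf; apply/subvP => b _.
  have -> : b = tr ((b / \tr Z) *: Z).
    by rewrite linearZ /= trE -[RHS]/(_ * _) divfK.
  by apply/memv_img/memvZ.
by rewrite dimvf /dim /= addn1 => -[].
Qed.

Lemma cyclic_vector_conj X c P : P \in unitmx ->
  cyclic_vector X c -> cyclic_vector (invmx P *m X *m P) (invmx P *m c).
Proof.
move=> Pu cX u; have [f Pu_f] := cX (P *m u); exists f.
have -> : horner_mx (invmx P *m X *m P) f = invmx P *m horner_mx X f *m P.
  elim/poly_ind: f {Pu_f} => [|f b IHf]; first by rewrite !rmorph0 mulmx0 mul0mx.
  rewrite !rmorphD !rmorphM /= !horner_mx_X !horner_mx_C IHf -!mulmxE.
  rewrite mulmxDr mulmxDl mul_mx_scalar -scalemxAl mulVmx // scalemx1.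
  by rewrite !mulmxA mulmxK.
by rewrite -[LHS](mulKmx Pu) Pu_f -!mulmxA mulKVmx.
Qed.

End CyclicVectors.

(** * The companion matrix of [x^m - d] and the matrix [X] *)

Section Shift.
Variables (R : comNzRingType) (k : nat).
Local Notation m := k.+2.

(** Standard basis columns, indexed by naturals so that shifting is the plain successor; the column
    is 0 once [i] reaches [m]. *)
Definition fcol i : 'cV[R]_m := \col_j (j == i :> nat)%:R.

Definition shift_mx d : 'M[R]_m :=
  \matrix_(i, j) ((i == j.+1 :> nat)%:R + d *+ ((i == 0) && (j == ord_max))).

Lemma mul_fcol n (M : 'M[R]_(n, m)) (j : 'I_m) : M *m fcol j = col j M.
Proof.
by rewrite colE; congr (_ *m _); apply/matrixP => i l; rewrite !mxE ord1 andbT.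
Qed.

Lemma mul_tr_fcol n (M : 'M[R]_(m, n)) (i : 'I_m) : (fcol i)^T *m M = row i M.
Proof. by apply: trmx_inj; rewrite trmx_mul trmxK mul_fcol tr_row. Qed.

Lemma shift_fcol d i : (i < k.+1)%N -> shift_mx d *m fcol i = fcol i.+1.
Proof.
move=> ik; have im : (i < m)%N by lia.
rewrite (mul_fcol _ (Ordinal im)); apply/colP => j; rewrite !mxE.
by rewrite -[_ == ord_max]val_eqE /= (ltn_eqF ik) andbF mulr0n addr0.
Qed.

Lemma shift_fcol_last d : shift_mx d *m fcol k.+1 = d *: fcol 0.
Proof.
rewrite (mul_fcol _ ord_max); apply/colP => j; rewrite !mxE eqxx andbT /=.
by rewrite (ltn_eqF (ltn_ord j)) add0r mulr_natr.
Qed.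

Lemma tr_fcol_shift d i : (i < k.+1)%N ->
  (fcol i.+1)^T *m shift_mx d = (fcol i)^T.
Proof.
move=> ik; have im : (i.+1 < m)%N by lia.
rewrite (mul_tr_fcol _ (Ordinal im)); apply/rowP => j; rewrite !mxE.
by rewrite -[_ == 0]val_eqE /= addr0 eqSS eq_sym.
Qed.

Lemma shiftX_fcol d r : (r < m)%N -> shift_mx d ^+ r *m fcol 0 = fcol r.
Proof.
elim: r => [|r IHr] rm; first by rewrite expr0 mul1mx.
by rewrite exprS -mulmxE -mulmxA IHr ?shift_fcol //; lia.
Qed.

(** It suffices to check this on [fcol 0], whose images under powers of the shift are the whole
    basis. *)
Lemma shiftXm d : shift_mx d ^+ m = d%:M.
Proof.
have E0 : shift_mx d ^+ m *m fcol 0 = d *: fcol 0.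
  by rewrite exprS -mulmxE -mulmxA shiftX_fcol // shift_fcol_last.
apply/matrixP => i j; suff /colP/(_ i) : col j (shift_mx d ^+ m) = col j d%:M.
  by rewrite ![col _ _ _ _]mxE.
rewrite -!mul_fcol -(shiftX_fcol d (ltn_ord j)) mulmxA mulmxE -exprD addnC.
by rewrite exprD -mulmxE -mulmxA E0 mul_scalar_mx scalemxAr.
Qed.

Lemma tr_fcol_shiftX d r i : (r + i < m)%N ->
  (fcol (r + i))^T *m shift_mx d ^+ r = (fcol i)^T.
Proof.
elim: r => [|r IHr] rm; first by rewrite expr0 mulmx1.
by rewrite exprS -mulmxE mulmxA tr_fcol_shift ?IHr //; lia.
Qed.

(** The power moves each basis column to a multiple of a different one, with index shifted by [r]
    modulo [m]. *)
Lemma trace_shiftX d r : (0 < r < m)%N -> \tr (shift_mx d ^+ r) = 0.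
Proof.
move=> /andP[r0 rm]; rewrite /mxtrace big1 // => j _.
have -> : (shift_mx d ^+ r) j j = (shift_mx d ^+ r *m fcol j) j 0.
  by rewrite mul_fcol mxE.
rewrite -(shiftX_fcol d (ltn_ord j)) mulmxA mulmxE -exprD.
have [rj|rj] := ltnP (r + j) m.
  by rewrite shiftX_fcol // !mxE (_ : _ == _ = false) //; apply/eqP; lia.
rewrite -(subnK rj) addnC exprD shiftXm -mulmxE -mulmxA mul_scalar_mx.
have lt : (r + j - m < m)%N by have := ltn_ord j; lia.
rewrite shiftX_fcol // !mxE (_ : _ == _ = false) ?mulr0 //; apply/eqP; lia.
Qed.

Definition regular_mx a d : 'M[R]_(1 + m) :=
  block_mx 0 0 (a *: fcol 0) (shift_mx d).

Lemma trace_regular_mx a d : \tr (regular_mx a d) = 0.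
Proof.
by rewrite mxtrace_block raddf0 add0r -[shift_mx d]expr1 trace_shiftX.
Qed.

Lemma trace_regular_mxX a d :
  \tr ((regular_mx a d : 'M_m.+1) ^+ m) = d *+ m.
Proof.
have E r : (regular_mx a d : 'M_m.+1) ^+ r.+1
    = block_mx 0 0 (shift_mx d ^+ r *m (a *: fcol 0)) (shift_mx d ^+ r.+1)
    :> 'M_(1 + m).
  elim: r => [|r IHr]; first by rewrite !expr1 expr0 mul1mx.
  rewrite exprS IHr -mulmxE [LHS](@mulmx_block _ 1 m 1 m 1 m).
  rewrite !mul0mx !mulmx0 !addr0 !add0r mulmxA.
  by rewrite mulmxE -!exprS.
rewrite E [LHS](@mxtrace_block _ 1 m) shiftXm mxtrace_scalar.
by rewrite raddf0 add0r.
Qed.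

End Shift.

Lemma map_regular_mx (R S : comNzRingType) (f : {rmorphism R -> S}) k a d :
  map_mx f (regular_mx k a d) = regular_mx k (f a) (f d).
Proof.
rewrite /regular_mx map_block_mx !raddf0 map_mxZ; congr block_mx.
  by congr (_ *: _); apply/colP => j; rewrite !mxE rmorph_nat.
by apply/matrixP => i j; rewrite !mxE rmorphD rmorph_nat rmorphMn.
Qed.

(** * A cyclic vector for [X] over a field *)

Section RegularField.
Variables (K : fieldType) (k : nat).
Local Notation m := k.+2.

(** For nonzero [a] the vector [e0] reaches [f 0] and then the whole chain. For [a = 0] the start is
    [e0 + f 0]: its image is [f 1], and going round the cycle, with [d] invertible, recovers [f 0]
    and then [e0]. *)
Lemma regular_mx_cyclic (a d : K) : (a != 0) || (d != 0) ->
  exists c, cyclic_vector (regular_mx k a d : 'M_m.+1) c.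
Proof.
pose X : 'M_m.+1 := regular_mx k a d.
pose e0 : 'cV[K]_m.+1 := col_mx (1%:M : 'M_1) (0 : 'cV_m).
pose f i : 'cV[K]_m.+1 := col_mx (0 : 'M_1) (fcol K k i).
have Xe0 : X *m e0 = a *: f 0%N.
  rewrite /X /regular_mx /e0 /f.
  rewrite [LHS](@mul_block_col _ 1 m 1 m 1) !mul0mx mulmx0 mulmx1 !addr0.
  by rewrite [RHS](@scale_col_mx _ 1 m 1) scaler0.
have Xf i : X *m f i = col_mx (0 : 'M_1) (shift_mx k d *m fcol K k i).
  rewrite /X /regular_mx /f.
  by rewrite [LHS](@mul_block_col _ 1 m 1 m 1) !mul0mx mulmx0 !add0r.
have XfS i : (i < k.+1)%N -> X *m f i = f i.+1.
  by move=> ik; rewrite Xf shift_fcol.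
have Xlast : X *m f k.+1 = d *: f 0%N.
  by rewrite Xf shift_fcol_last [RHS](@scale_col_mx _ 1 m 1) scaler0.
have basis c : cyclic_span X c e0 -> cyclic_span X c (f 0%N) ->
    cyclic_vector X c.
  move=> ce0 cf0; have cf i : (i < m)%N -> cyclic_span X c (f i).
    elim: i => [|i IHi] im //; rewrite -XfS; last by lia.
    by apply/cyclic_spanM/IHi; lia.
  apply: cyclic_vector_basis => i.
  have [i0|i0] := eqVneq i 0.
    rewrite (_ : delta_mx i 0 = e0) //; apply/colP => j.
    rewrite i0 !mxE eqxx andbT -[j == 0]val_eqE /=.
    by case: splitP => l jl; rewrite !mxE jl ?ord1.
  rewrite (_ : delta_mx i 0 = f i.-1); last first.
    have {}i0 : (i : nat) != 0%N by apply: contra_neq i0 => ?; apply/val_inj.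
    apply/colP => j; rewrite !mxE eqxx andbT -[j == i]val_eqE /=.
    case: splitP => l jl; rewrite !mxE jl ?ord1 /=.
      by rewrite eq_sym (negbTE i0).
    by case: (val i) i0.
  by apply: cf; have := ltn_ord i; lia.
have [a_neq0 _|a0 /= d_neq0] := boolP (a != 0).
  exists e0; apply: basis; first exact: cyclic_span_id.
  have -> : f 0%N = a^-1 *: (X *m e0) by rewrite Xe0 scalerA mulVf // scale1r.
  by apply/cyclic_spanZ/cyclic_spanM/cyclic_span_id.
exists (e0 + f 0%N).
have cf i : (i < k.+1)%N -> cyclic_span X (e0 + f 0%N) (f i.+1).
  elim: i => [_|i IHi ik].
    have -> : f 1%N = X *m (e0 + f 0%N).
      by rewrite mulmxDr Xe0 (eqP (negbNE a0)) scale0r add0r XfS.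
    exact/cyclic_spanM/cyclic_span_id.
  by rewrite -XfS //; apply/cyclic_spanM/IHi; lia.
have cf0 : cyclic_span X (e0 + f 0%N) (f 0%N).
  have {2}-> : f 0%N = d^-1 *: (X *m f k.+1).
    by rewrite Xlast scalerA mulVf // scale1r.
  by apply/cyclic_spanZ/cyclic_spanM; apply: cf.
apply: basis => //.
have {2}-> : e0 = (e0 + f 0%N) + (- 1) *: f 0%N by rewrite scaleN1r addrK.
by apply: cyclic_spanD; [apply: cyclic_span_id | apply: cyclic_spanZ].
Qed.
End RegularField.

(** * Solving the commutator equation *)

Section Commutator.
Variables (R : idomainType) (k : nat).
Local Notation m := k.+2.
Local Notation S := (shift_mx k).
Local Notation f := (fcol R k).

(** All columns of the equation but the last define [Y] recursively from a zero first column; the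
    trace conditions are exactly what the last column needs. *)
Lemma shift_commutator (d : R) (C : 'M_m) :
    (forall r, (r < m)%N -> \tr (S d ^+ r *m C) = 0) ->
    (forall i j, i != j -> divides d (C i j)) ->
  exists Y, [/\ S d *m Y - Y *m S d = C, Y *m f 0 = 0 & divides d (\tr Y)].
Proof.
move=> trC offC.
pose y := fix y j : 'cV_m := if j is i.+1 then S d *m y i - C *m f i else 0.
pose Y : 'M_m := \matrix_(i, j) y j i 0.
have Yf j : (j < m)%N -> Y *m f j = y j.
  move=> jm; rewrite (mul_fcol _ (Ordinal jm)).
  by apply/colP => i; rewrite !mxE.
(* The recursion changes a diagonal entry into the next one by subtracting an entry of [C] just
   below the diagonal. *)
have diagY (i : 'I_m) : divides d (Y i i).
  rewrite mxE; case: i => /=; elim=> [|i IHi] im.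
    by exists 0; rewrite mxE mul0r.
  have im' : (i < m)%N by lia.
  have [q qE] := IHi im'.
  have [|c cE] := offC (Ordinal im) (Ordinal im').
    by rewrite -val_eqE /=; lia.
  exists (q - c); rewrite mulrBl -cE -qE mxE; congr (_ + _).
    have dotf (j : nat) (jm : (j < m)%N) (M : 'cV_m) :
        M (Ordinal jm) 0 = ((f j)^T *m M) 0 0.
      by rewrite (mul_tr_fcol _ (Ordinal jm)) mxE.
    by rewrite !dotf mulmxA tr_fcol_shift.
  by rewrite mxE (mul_fcol _ (Ordinal im')) mxE.
exists Y; split; last first.
- have /choice[q qE] := diagY; exists (\sum_i q i).
  by rewrite mulr_suml; apply: eq_bigr => i _.
- by rewrite Yf.
apply/eqP; rewrite -subr_eq0; set D := _ - C.
have Df j : (j < k.+1)%N -> D *m f j = 0.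
  move=> jk; rewrite !mulmxBl -!mulmxA shift_fcol // !Yf; try lia.
  by rewrite /= subKr subrr.
pose z := D *m f k.+1.
have DE : D = z *m (f k.+1)^T.
  apply/matrixP => i j; rewrite [RHS]mxE big_ord1 [_^T _ _]mxE [f _ _ _]mxE.
  have [jk|jk] := eqVneq (j : nat) k.+1.
    have <- : ord_max = j by apply/val_inj.
    by rewrite mulr1 /z (mul_fcol _ ord_max) [RHS]mxE.
  rewrite mulr0; have /colP/(_ i) : D *m f j = 0.
    by apply: Df; have := ltn_ord j; lia.
  by rewrite mul_fcol !mxE.
(* This entry of [z] is the trace of [S d ^+ r *m D], in which the commutator contributes 0 because
   [S d] commutes with its powers. *)
have zE r : (r < m)%N -> ((f (k.+1 - r))^T *m z) 0 0 = 0.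
  move=> rm; rewrite -(@tr_fcol_shiftX _ _ d r) ?subnKC; try lia.
  rewrite -trace_mx11 -mulmxA mxtrace_mulC -mulmxA -DE.
  rewrite !mulmxBr !raddfB /= trC // subr0.
  rewrite [X in _ - X](_ : _ = \tr (S d ^+ r *m (S d *m Y))) ?subrr //.
  by rewrite [in LHS]mulmxA [LHS]mxtrace_mulC !mulmxA !mulmxE -exprS exprSr.
rewrite DE (_ : z = 0) ?mul0mx //; apply/colP => i; rewrite [RHS]mxE.
have := zE (k.+1 - i)%N; rewrite subKn; last by have := ltn_ord i; lia.
by rewrite mul_tr_fcol mxE; apply; lia.
Qed.

(** The upper right block [- (f 0)^T] of the solution yields both [a] in the corner and [d] times
    the last basis row. Its product with [a *: f 0] adds the diagonal term [f 0 *m (f 0)^T] to [C],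
    which brings [\tr C] to [a *+ m.+1 + d * \tr B]. *)
Lemma regular_mx_commutator (a d : R) (be : 'cV_m) (B : 'M_m) :
    a *+ m.+1 + d * \tr B = 0 ->
    (forall r, (0 < r < m)%N -> \tr (S d ^+ r *m B) = 0) ->
  exists Y : 'M_(1 + m), \tr Y = 0 /\
    regular_mx k a d *m Y - Y *m regular_mx k a d
    = a%:M + d *: block_mx 0 (f k.+1)^T be B.
Proof.
move=> trB SB; pose C := a *: (1%:M + f 0 *m (f 0)^T) + d *: B.
have f0f0 : (f 0)^T *m f 0 = 1%:M.
  rewrite (mul_tr_fcol _ 0); apply/matrixP => i j.
  by rewrite !mxE !ord1 eqxx.
have [r rm|i j ij|Y [SY Yf0 [q trY]]] := @shift_commutator d C.
- rewrite /C mulmxDr -!scalemxAr mulmxDr mulmx1 mulmxA mxtraceD !mxtraceZ.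
  rewrite mxtraceD [X in a * (_ + X)]mxtrace_mulC shiftX_fcol //.
  case: r rm => [_|r rm].
    rewrite expr0 mul1mx f0f0 mxtrace1 mxtrace1 -trB; ring.
  rewrite trace_shiftX // SB // (mul_tr_fcol _ 0) trace_mx11 !mxE /=; ring.
- exists (B i j); rewrite /C !mxE big_ord1 !mxE (negbTE ij) mulr0n.
  case: (eqVneq (i : nat) 0%N) => [i0|_]; last by rewrite mul0r; ring.
  rewrite (_ : (j : nat) == 0%N = false) ?mulr0; first by ring.
  by apply: contra_neqF ij => /eqP j0; apply/val_inj; rewrite /= i0 j0.
(* The corner cancels [\tr Y = q * d]. One more factor [S d] turns [S d ^+ k.+1] into [d], and the
   summand with [a * q] offsets the effect of the corner. *)
exists (block_mx (- (q * d))%:M (- (f 0)^T)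
  (S d ^+ k.+1 *m (be + (a * q) *: f 0)) Y); split.
  by rewrite mxtrace_block mxtrace_scalar trY; ring.
rewrite /regular_mx !mulmx_block !mul0mx !mulmx0 !addr0 !add0r.
rewrite opp_block_mx add_block_mx !sub0r.
rewrite (scalar_mx_block 1 m) scale_block_mx add_block_mx !scaler0 !addr0 !add0r.
congr block_mx.
- by rewrite mulNmx -scalemxAr f0f0 opprK scalemx1.
- rewrite mulNmx opprK (mul_tr_fcol _ 0); apply/rowP => j; rewrite !mxE /=.
  by rewrite add0r -mulr_natr -[_ == ord_max]val_eqE.
- rewrite -scalemxAr Yf0 scaler0 subr0 mulmxA mulmxE -exprS shiftXm.
  rewrite mul_mx_scalar mul_scalar_mx scalerDr !scalerA addrCA.
  rewrite -scalerDl (_ : - (q * d) * a + d * (a * q) = 0); last by ring.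
  by rewrite scale0r addr0.
- rewrite mulmxN -scalemxAl -addrA SY /C scalerDr scalemx1.
  by rewrite -(addrA a%:M) addrCA addKr.
Qed.
End Commutator.

(** * Killing the trace obstructions by a unipotent conjugation *)

Section BlockNormalForm.
Variable R : idomainType.
Hypothesis R_pid : is_pid R.

Lemma trace0_block_normal_form k (A : 'M[R]_(1 + k.+2)) : \tr A = 0 ->
  exists P g a d l s be (B : 'M_k.+2),
    [/\ P \in unitmx,
        P *m A *m invmx P
          = g *: (a%:M + d *: block_mx 0 (fcol R k k.+1)^T be B),
        l * a + s * d = 1, a *+ k.+3 + d * \tr B = 0
      & forall r, (0 < r < k.+2)%N -> \tr (shift_mx k d ^+ r *m B) = 0].
Proof.
move=> trA; have [P [g [a [d [l [s [B]]]]]]] := trace0_normal_form R_pid trA.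
move=> [Pu PAP ls trB rowB]; pose B1 : 'M_(1 + k.+2) := B.
pose eta := (fcol R k k.+1)^T; pose B0 := drsubmx B1.
have uB1 : usubmx B1 = row_mx 0 eta.
  have -> : usubmx B1 = row 0 B.
    by apply/rowP => j; rewrite !mxE; congr (B _ _); apply/val_inj.
  rewrite rowB; apply/rowP => j; rewrite !mxE eqxx -[j == _]val_eqE /=.
  by case: splitP => i ->; rewrite !mxE ?ord1.
(* Conjugation by [Q] adds [h *m eta] to [B0], and [\tr (S^r *m h *m eta)] is entry [k.+1 - r] of
   [h], which is therefore prescribed for [0 < r]. The last entry is 0 so that [eta *m h = 0]
   preserves the first row. *)
pose h : 'cV[R]_k.+2 := \col_i
  if i == ord_max then 0 else - \tr (shift_mx k d ^+ (k.+1 - i) *m B0).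
have etah : eta *m h = 0.
  rewrite /eta (mul_tr_fcol _ ord_max); apply/matrixP => i j.
  by rewrite !mxE eqxx.
pose Q : 'M[R]_(1 + k.+2) := block_mx 1%:M 0 h 1%:M.
pose Q' : 'M[R]_(1 + k.+2) := block_mx 1%:M 0 (- h) 1%:M.
have QQ' : Q *m Q' = 1%:M.
  rewrite mulmx_block !mulmx0 !mul0mx !mulmx1 !mul1mx !addr0 add0r subrr.
  by rewrite -scalar_mx_block.
have [Qu _] := mulmx1_unit QQ'.
have Q'E : invmx Q = Q' by rewrite -[RHS](mulKmx Qu) QQ' mulmx1.
have QB : Q *m B1 *m Q' = block_mx 0 eta
    (dlsubmx B1 - (h *m eta + B0) *m h) (h *m eta + B0).
  rewrite -[B1 in LHS]submxK /ulsubmx /ursubmx uB1 row_mxKl row_mxKr.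
  rewrite !mulmx_block !mulmx0 !mul0mx !mulmx1 !mul1mx !addr0 !add0r.
  by rewrite !mulmxN etah oppr0.
have QP_unit : Q *m P \in unitmx by rewrite unitmx_mul Qu.
exists (Q *m P), g, a, d, l, s, (dlsubmx B1 - (h *m eta + B0) *m h),
  (h *m eta + B0); split=> //.
- rewrite -QB -Q'E.
  have -> : invmx (Q *m P) = invmx P *m invmx Q.
    apply: (can_inj (mulKmx QP_unit)); rewrite mulmxV // mulmxA.
    by rewrite mulmxK // mulmxV.
  rewrite !mulmxA -(mulmxA Q P) -(mulmxA Q (P *m A)) PAP -scalemxAr -scalemxAl.
  congr (_ *: _); rewrite mulmxDr mulmxDl mul_mx_scalar -scalemxAl mulmxV //.
  by rewrite scalemx1 -scalemxAr -scalemxAl.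
- have <- : \tr B1 = \tr (h *m eta + B0); last exact: trB.
  rewrite -[B1 in LHS]submxK mxtrace_block raddfD /= mxtrace_mulC etah.
  by rewrite /ulsubmx uB1 row_mxKl !raddf0.
move=> r /andP[r0 rm].
rewrite mulmxDr raddfD /= mulmxA mxtrace_mulC.
rewrite mulmxA.
have -> : eta *m shift_mx k d ^+ r = (fcol R k (k.+1 - r))^T.
  have := @tr_fcol_shiftX R k d r (k.+1 - r); rewrite subnKC; last by lia.
  by apply; lia.
have lt : (k.+1 - r < k.+2)%N by lia.
rewrite (mul_tr_fcol _ (Ordinal lt)) trace_mx11 !mxE -val_eqE /=.
rewrite (_ : _ == _ = false); last by apply/eqP; lia.
by rewrite subKn ?addNr //; lia.
Qed.

End BlockNormalForm.

(** * Conjugating back and reducing modulo maximal ideals *)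

Theorem theorem5p3 (R : idomainType) (R_pid : is_pid R) (n : nat)
    (n_ge3 : (3 <= n)%N) (A : 'M[R]_n) (A_sl : A \in sl_mx R n) :
  exists X Y : 'M[R]_n,
    [/\ X \in sl_mx R n, Y \in sl_mx R n, lie_mx X Y = A,
        forall p : maxideal R, gl_regular (mod_max p X)
      & forall p : maxideal R, ~~ is_scalar_mx (mod_max p A) ->
          sl_regular (mod_max p X)].
Proof.
case: n n_ge3 A A_sl => [|[|[|k]]] // _ A /eqP trA.
have [P [g [a [d [l [s [be [B]]]]]]]] := trace0_block_normal_form R_pid trA.
move=> [Pu PAP ls trB SB].
have [Y0 [trY0 XY0]] := regular_mx_commutator be trB SB.
pose X0 : 'M[R]_k.+3 := regular_mx k a d.
have conj_tr Z : \tr (invmx P *m Z *m P) = \tr Z.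
  by rewrite mxtrace_mulC mulKVmx.
(* Only [Y] carries the factor [g], so [X] stays regular modulo primes containing [g]. *)
exists (invmx P *m X0 *m P), (g *: (invmx P *m Y0 *m P)).
have cyc (p : maxideal R) : exists2 c : 'cV[residue_field p]_k.+3,
    cyclic_vector (mod_max p (invmx P *m X0 *m P)) c &
    exists2 T, T \in unitmx & mod_max p (invmx P *m X0 *m P) =
      invmx T *m regular_mx k (to_residue p a) (to_residue p d) *m T.
  pose T := mod_max p P.
  have TT : mod_max p (invmx P) *m T = 1%:M.
    by rewrite /mod_max -map_mxM mulVmx // map_mx1.
  have [_ Tu] := mulmx1_unit TT.
  have E : mod_max p (invmx P *m X0 *m P) =
      invmx T *m regular_mx k (to_residue p a) (to_residue p d) *m T.
    rewrite /mod_max !map_mxM -(map_regular_mx (to_residue p)).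
    congr (_ *m _ *m _).
    by rewrite -[LHS](mulmxK Tu) -/(mod_max p _) TT mul1mx.
  have ad : (to_residue p a != 0) || (to_residue p d != 0).
    rewrite -negb_and; apply/negP => /andP[/eqP a0 /eqP d0].
    have /eqP := congr1 (to_residue p) ls.
    by rewrite rmorphD !rmorphM /= a0 d0 !mulr0 addr0 rmorph1 eq_sym oner_eq0.
  have [c cX] := regular_mx_cyclic k ad.
  exists (invmx T *m c); last by exists T.
  by rewrite E; apply: cyclic_vector_conj.
split.
- by rewrite inE conj_tr trace_regular_mx.
- by rewrite inE mxtraceZ conj_tr trY0 mulr0.
- have PP Z W : invmx P *m Z *m P *m (invmx P *m W *m P)
      = invmx P *m (Z *m W) *m P.
    by rewrite !mulmxA mulmxK.
  rewrite /lie_mx -scalemxAr -scalemxAl -scalerBr !PP -mulmxBl -mulmxBr XY0.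
  by rewrite scalemxAl scalemxAr -PAP !mulmxA mulVmx // mul1mx mulmxKV.
- by move=> p; have [c /cyclic_gl_regular] := cyc p.
move=> p A_nonscalar; have [c cX [T Tu XE]] := cyc p.
have d_neq0 : to_residue p d != 0.
  apply: contra A_nonscalar => /eqP d0.
  apply/is_scalar_mxP; exists (to_residue p (g * a)).
  have AE : A = (g * a)%:M
      + d *: (invmx P *m (g *: block_mx 0 (fcol R k k.+1)^T be B) *m P).
    rewrite -[LHS](mulKmx Pu) -[P *m A](mulmxKV Pu) PAP scalerDr.
    rewrite scale_scalar_mx scalerA (mulrC g d) -scalerA mulmxDl mulmxDr.
    by rewrite mul_scalar_mx -scalemxAr mulVmx // scalemx1 -scalemxAl
      -scalemxAr mulmxA.
  by rewrite /mod_max AE map_mxD map_mxZ map_scalar_mx /= d0 scale0r addr0.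
(* The identity has trace [k.+3]. If this vanishes modulo [p], then [k.+2] is -1 there, and the
   power [k.+2] of [X] has nonzero trace [d *+ k.+2]. *)
have [n0|n_neq0] := eqVneq (k.+3%:R : residue_field p) 0; last first.
  apply: (cyclic_sl_regular (Z := 1%:M) cX); last by rewrite mxtrace1.
  by rewrite mem_cent_gl mulmx1 mul1mx.
pose M : 'M_k.+3 := regular_mx k (to_residue p a) (to_residue p d).
have conj_cent N : N *m M = M *m N ->
    invmx T *m N *m T \in cent_gl (mod_max p (invmx P *m X0 *m P)).
  move=> NM; rewrite mem_cent_gl XE -/M !mulmxA !mulmxK //.
  by rewrite -(mulmxA _ N) NM mulmxA.
apply: (cyclic_sl_regular (Z := invmx T *m M ^+ k.+2 *m T) cX).
  by apply: conj_cent; rewrite !mulmxE -exprS -exprSr.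
rewrite mxtrace_mulC mulKVmx // trace_regular_mxX -mulr_natr mulf_neq0 //.
apply: contraTneq (oner_neq0 (residue_field p)) => m0.
by rewrite negbK -n0 -[k.+3]addn1 natrD m0 add0r.
Qed.
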